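(* Let $C\subseteq\mathbb{R}^n$ be a nonempty compact convex set and let $x\in C$. Then $$\kappa(x)\leq \ell_C .$$
   Context: For a nonempty compact convex set $C$ and $x\in C$, $\kappa(x)$ denotes the smallest integer $k$ such that $x$ can be written as a convex combination of $k$ extreme points of $C$. A convex subset $\mathcal{F}\subseteq C$ is a face of $C$ if, whenever $u,v\in C$ and $\alpha u+(1-\alpha)v\in\mathcal{F}$ for some $0<\alpha<1$, then $u,v\in\mathcal{F}$; an extreme point is a face consisting of a single point. A chain of faces of $C$ is a finite sequence $\mathcal{F}_1\supsetneq\cdots\supsetneq\mathcal{F}_\ell$ of nonempty faces of $C$, each properly containing the next; its length is the number $\ell$ of faces. $\ell_C$ is the length of the longest chain of faces of $C$. *)

(* Defs.v *)
From mathcomp Require Import all_boot all_order all_algebra.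
From mathcomp Require Import all_classical all_reals all_analysis.
Set Implicit Arguments.
Unset Strict Implicit.
Unset Printing Implicit Defensive.
Import Order.TTheory GRing.Theory Num.Theory.
Import numFieldNormedType.Exports.

Local Open Scope classical_set_scope.
Local Open Scope ring_scope.

(* The empty set is a face; only nonempty faces occur in chains. *)
Definition face (R : realType) (V : lmodType R) (C F : set V) : Prop :=
  [/\ F `<=` C, convex_set F &
      forall (u v : V) (a : R), C u -> C v -> 0 < a < 1 ->
        F (a *: u + (1 - a) *: v) -> F u /\ F v].

Definition extreme_point (R : realType) (V : lmodType R) (C : set V) (e : V) :
  Prop := face C [set e].

(* Zero weights and repeated points are allowed, which does not affect the
   minimal number of points; k = 0 is impossible since the weights sum to 1. *)
Definition conv_comb_extreme (R : realType) (V : lmodType R) (C : set V)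
    (x : V) (k : nat) : Prop :=
  exists (e : 'I_k -> V) (w : 'I_k -> R),
    [/\ forall i, extreme_point C (e i), forall i, 0 <= w i,
        \sum_i w i = 1 & x = \sum_i w i *: e i].

(* kappa(x) and the maximal chain length are given as relations, so that a
   statement about their values also asserts that the minimum and the maximum
   are attained. *)
Definition is_kappa (R : realType) (V : lmodType R) (C : set V)
    (x : V) (k : nat) : Prop :=
  conv_comb_extreme C x k /\
  forall m : nat, conv_comb_extreme C x m -> (k <= m)%N.

Definition face_chain (R : realType) (V : lmodType R) (C : set V)
    (s : seq (set V)) : Prop :=
  (forall i : nat, (i < size s)%N ->
     face C (nth set0 s i) /\ nth set0 s i !=set0) /\
  (forall i : nat, (i.+1 < size s)%N ->
     nth set0 s i.+1 `<` nth set0 s i).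

Definition is_chain_length (R : realType) (V : lmodType R) (C : set V)
    (l : nat) : Prop :=
  (exists2 s : seq (set V), face_chain C s & size s = l) /\
  forall s : seq (set V), face_chain C s -> (size s <= l)%N.

(* Main.v *)
Require Import Defs.
From mathcomp Require Import all_boot all_order all_algebra.
From mathcomp Require Import all_classical all_reals all_analysis.
From mathcomp Require Import ring lra.
Set Implicit Arguments.
Unset Strict Implicit.
Unset Printing Implicit Defensive.
Import Order.TTheory GRing.Theory Num.Theory.
Import numFieldNormedType.Exports.
Local Open Scope classical_set_scope.
Local Open Scope ring_scope.

(** Two facts about faces carry the proof.

Dimension drops strictly along a chain of faces ([rel_frame_rank_lt]), so a
chain in 'rV[R]_n has at most n + 1 members ([face_chain_size]) and the
longest chain exists. The reason is that a nonempty convex set F has a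
relatively interior point p: from p one can move a little within F in every
direction parallel to the affine hull of F ([rel_frame_exists]). If F is a
face of C, any q of C in the affine hull of F is the endpoint of a segment
of C through p that ends in F on the other side, so q lies in F; hence F is
the trace on C of its affine hull ([rel_frame_face]), and a face with the
same affine hull as C is C itself. This description also shows that faces of
compact sets are compact ([face_compact]).

Every x in C is a convex combination of s extreme points for some chain of s
faces ([extreme_decomposition_chain]). If x is an extreme point, the chain
consisting of C works. Otherwise take an extreme point e of C and follow the
ray from e through x up to the last point y of C ([exit_point]). The smallest
face F containing y is made of the points z such that the segment from z to y
can be prolonged beyond y inside C ([min_face]); it misses e, because the ray
stops at y. So F is a face of smaller dimension, and by induction y is a
combination of as many extreme points of F as there are members in some chain
of F. Adding e to the points and C to the chain gives the result for x, which
lies between e and y. The same induction provides e: unless C is a single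
point, some ray from x inside C exits in a proper face, which has extreme
points.

The minimum kappa(x) is at most s, and s is at most the maximal length of a
chain. *)

(** * Convex sets and feasible directions *)

Lemma convex_setP (R : realType) (V : lmodType R) (C : set V) :
  convex_set C <-> forall (u v : V) (a : R), C u -> C v -> 0 < a < 1 ->
    C (a *: u + (1 - a) *: v).
Proof.
split=> [cC u v a Cu Cv /andP[a0 a1]|cC].
  have := cC u v (Itv01 (ltW a0) (ltW a1)); rewrite !inE; exact.
apply/convex_setW => u v /set_mem Cu /set_mem Cv k k0 k1.
by apply/mem_set/cC => //; apply/andP.
Qed.

(** The cone of directions in which one can start from p and remain in C for a
while; p + t v is required in C for a single t > 0, which for convex C and
p in C gives the whole segment. *)
Definition feasible (R : realType) (V : lmodType R) (C : set V) (p v : V) :=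
  exists2 t : R, 0 < t & C (p + t *: v).

Lemma feasible0 (R : realType) (V : lmodType R) (C : set V) (p : V) :
  C p -> feasible C p 0.
Proof. by move=> Cp; exists 1; rewrite ?scaler0 ?addr0. Qed.

Lemma feasible_sub (R : realType) (V : lmodType R) (C : set V) (p q : V) :
  C q -> feasible C p (q - p).
Proof. by move=> Cq; exists 1; rewrite // scale1r addrC subrK. Qed.

Lemma feasibleZ (R : realType) (V : lmodType R) (C : set V) (p v : V) (c : R) :
  0 < c -> feasible C p v -> feasible C p (c *: v).
Proof.
move=> c0 [t t0 Ct]; exists (t / c); first exact: divr_gt0.
by rewrite scalerA divfK // gt_eqF.
Qed.

(** The feasible directions of a convex set form a cone closed under addition:
averaging p + s u and p + t v with weights proportional to 1/s and 1/t makes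
the coefficients of u and v equal. *)
Lemma feasibleD (R : realType) (V : lmodType R) (C : set V) (p u v : V) :
  convex_set C -> feasible C p u -> feasible C p v -> feasible C p (u + v).
Proof.
move=> /convex_setP cC [s s0 Cs] [t t0 Ct].
have st0 : 0 < s + t by exact: addr_gt0.
have stn0 : s + t != 0 by rewrite gt_eqF.
exists (s * t / (s + t)); first by rewrite divr_gt0 // mulr_gt0.
suff -> : p + (s * t / (s + t)) *: (u + v) =
    (t / (s + t)) *: (p + s *: u) + (1 - t / (s + t)) *: (p + t *: v).
  apply: cC => //; rewrite divr_gt0 //= ltr_pdivrMr // mul1r.
  by rewrite ltrDr.
rewrite !scalerDr addrACA -scalerDl subrKC scale1r !scalerA.
by congr (_ + (_ *: _ + _ *: _)); field.
Qed.

(** * Faces *)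

Lemma face_refl (R : realType) (V : lmodType R) (C : set V) :
  convex_set C -> face C C.
Proof. by move=> cC; split=> // u v a Cu Cv _ _. Qed.

Lemma face_trans (R : realType) (V : lmodType R) (C F G : set V) :
  face C F -> face F G -> face C G.
Proof.
move=> [FC _ fF] [GF cG fG]; split=> //; first exact: subset_trans FC.
move=> u v a Cu Cv a01 Guv.
by have [Fu Fv] := fF _ _ _ Cu Cv a01 (GF _ Guv); exact: fG Guv.
Qed.

(** Being a face is only tested on segments of the ambient set, so it is
inherited by any smaller ambient set that still contains the face. *)
Lemma face_subface (R : realType) (V : lmodType R) (C F G : set V) :
  face C F -> face C G -> F `<=` G -> face G F.
Proof.
move=> [_ cF fF] [GC _ _] FG; split=> // u v a Gu Gv.
by apply: fF; exact: GC.
Qed.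

(** If F contains a point r slightly beyond p on the line from q, then p is
strictly inside the segment from r to q, and the face property gives q. *)
Lemma face_feasible (R : realType) (V : lmodType R) (C F : set V) (p q : V) :
  face C F -> F p -> C q -> feasible F p (p - q) -> F q.
Proof.
move=> [FC _ fF] Fp Cq [t t0 Ft].
have t10 : 0 < 1 + t by rewrite addr_gt0.
have t1n0 : 1 + t != 0 by rewrite gt_eqF.
have a01 : 0 < (1 + t)^-1 < 1.
  by rewrite invr_gt0 t10 invf_lt1 // ltrDl.
apply: (fF _ _ _ (FC _ Ft) Cq a01 _).2.
suff -> : (1 + t)^-1 *: (p + t *: (p - q)) + (1 - (1 + t)^-1) *: q = p by [].
rewrite scalerBr addrA -{1}[p]scale1r -scalerDl scalerBr scalerA.
rewrite mulVf // scale1r scalerA -addrA addrC -scaleNr -scalerDl.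
rewrite [X in X *: _](_ : _ = 0) ?scale0r ?add0r //; by field.
Qed.

(** The smallest face of C containing y: besides y it consists of the z in C
such that y is interior to some segment of C starting at z. *)
Definition min_face (R : realType) (V : lmodType R) (C : set V) (y : V) :
  set V := [set z | C z /\ feasible C y (y - z)].

Lemma mem_min_face (R : realType) (V : lmodType R) (C : set V) (y : V) :
  C y -> min_face C y y.
Proof. by move=> Cy; split=> //; rewrite subrr; exact: feasible0. Qed.

Lemma min_face_face (R : realType) (V : lmodType R) (C : set V) (y : V) :
  convex_set C -> face C (min_face C y).
Proof.
move=> cC.
have yB u v (a : R) : y - (a *: u + (1 - a) *: v) =
    a *: (y - u) + (1 - a) *: (y - v).
  by rewrite !scalerBr addrACA -scalerDl subrKC scale1r opprD.
have half u v (a : R) : C v -> 0 < a < 1 ->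
    feasible C y (y - (a *: u + (1 - a) *: v)) -> feasible C y (y - u).
  move=> Cv /andP[a0 a1]; rewrite yB => fuv.
  (* v - y is feasible because v is in C; adding a multiple of it cancels the
     contribution of v and leaves a (y - u). *)
  have -> : y - u = a^-1 *: ((a *: (y - u) + (1 - a) *: (y - v))
      + (1 - a) *: (v - y)).
    rewrite -addrA -scalerDr [y - v + _]addrC subrKA subrr scaler0 addr0.
    by rewrite scalerA mulVf ?scale1r // gt_eqF.
  apply: feasibleZ; first by rewrite invr_gt0.
  apply: feasibleD => //; apply: feasibleZ; first by rewrite subr_gt0.
  exact: feasible_sub.
split=> [z []//||u v a Cu Cv a01 [_ fuv]].
- apply/convex_setP => u v a [Cu fu] [Cv fv] a01; split.
    by move/convex_setP: cC; apply.
  case/andP: a01 => a0 a1; rewrite yB.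
  by apply: feasibleD => //; apply: feasibleZ => //; rewrite subr_gt0.
- split; split=> //; first exact: half fuv.
  apply: (half v u (1 - a) Cu); last by rewrite subKr [_ + a *: u]addrC.
  by case/andP: a01 => a0 a1; rewrite subr_gt0 a1 ltrBlDr ltrDl.
Qed.

(** * Relative interior and dimension *)

(** The point p is relatively interior to C and the row space of A is the
direction space of the affine hull of C, so that the rank of A is the dimension
of C. The second clause alone says that this row space is not too large, the
third that it is not too small. *)
Definition rel_frame (R : realType) (n : nat) (C : set 'rV[R]_n)
    (p : 'rV[R]_n) (A : 'M[R]_n) : Prop :=
  [/\ C p, forall v : 'rV_n, (v <= A)%MS -> feasible C p v &
      forall q : 'rV_n, C q -> (q - p <= A)%MS].

(** Among the points p of C and the spaces of directions feasible at p, take a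
pair of maximal rank. If q - p were missing from the space, then at the midpoint
m of p and q all the former directions would still be feasible, by convexity,
and so would q - p and p - q: the rank would not be maximal. *)
Lemma rel_frame_exists (R : realType) (n : nat) (C : set 'rV[R]_n) :
  convex_set C -> C !=set0 -> exists p A, rel_frame C p A.
Proof.
move=> cC [p0 Cp0].
pose P (r : nat) := `[< exists p (A : 'M[R]_n),
  [/\ C p, forall v : 'rV_n, (v <= A)%MS -> feasible C p v & \rank A = r] >].
have P0 : exists r, P r.
  exists 0%N; apply/asboolP; exists p0, 0; split=> //; last exact: mxrank0.
  by move=> v /[!submx0] /eqP ->; exact: feasible0.
have Pn r : P r -> (r <= n)%N.
  by move=> /asboolP [p [A [_ _ <-]]]; exact: rank_leq_row.
case: (ex_maxnP P0 Pn) => r /asboolP[p [A [Cp fA rA]]] rmax.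
exists p, A; split=> // q Cq; apply: contrapT => /negP qA.
pose m := 2^-1 *: p + (1 - 2^-1) *: q.
have h01 : 0 < (2^-1 : R) < 1 by lra.
have Cm : C m by move/convex_setP: cC; apply.
have fm u : feasible C p u -> feasible C m u.
  move=> [s s0 Cs]; exists (2^-1 * s); first by rewrite mulr_gt0 ?invr_gt0.
  have -> : m + (2^-1 * s) *: u = 2^-1 *: (p + s *: u) + (1 - 2^-1) *: q.
    by rewrite scalerDr scalerA addrAC.
  by move/convex_setP: cC; apply.
have fqp : feasible C m (q - p).
  have -> : q - p = 2 *: (q - m).
    by apply/rowP => i; rewrite !mxE; field.
  by apply: feasibleZ => //; exact: feasible_sub.
have fpq : feasible C m (p - q).
  have -> : p - q = 2 *: (p - m).
    by apply/rowP => i; rewrite !mxE; field.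
  by apply: feasibleZ => //; exact: feasible_sub.
pose B := (A + <<q - p>>)%MS.
have AB : (A < B)%MS.
  rewrite ltmxE addsmxSl /=; apply: contra qA; apply: submx_trans.
  by rewrite (submx_trans _ (addsmxSr _ _)) // genmxE.
have /rmax : P (\rank B).
  apply/asboolP; exists m, B; split=> // v.
  rewrite /B => /sub_addsmxP[[u w] /= ->].
  apply: feasibleD => //; first by apply: fm; apply: fA; exact: submxMl.
  have : (w *m <<q - p>>%MS <= q - p)%MS.
    by apply: submx_trans (submxMl _ _) _; rewrite genmxE.
  move=> /sub_rVP[c ->].
  have [c0|c0|->] := ltgtP c 0; last by rewrite scale0r; exact: feasible0.
    by rewrite -opprB scalerN -scaleNr; apply: feasibleZ; rewrite ?oppr_gt0.
  exact: feasibleZ.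
by move: AB; rewrite ltmxErank rA => /andP[_]; rewrite ltnNge => /negP.
Qed.

Lemma rel_frame_sub (R : realType) (n : nat) (F G : set 'rV[R]_n) p A q B :
  F `<=` G -> rel_frame F p A -> rel_frame G q B -> (A <= B)%MS.
Proof.
move=> FG [Fp fA _] [_ _ GB]; apply/rV_subP => v /fA[t t0 Ft].
have -> : v = t^-1 *: ((p + t *: v - q) - (p - q)).
  by rewrite opprB addrA subrK addrC addKr scalerA mulVf ?scale1r // gt_eqF.
by rewrite scalemx_sub // addmx_sub ?eqmx_opp ?GB //; exact: FG.
Qed.

(** A face of C is the trace on C of its affine hull, since its relatively
interior point can be moved away from any point of this hull. *)
Lemma rel_frame_face (R : realType) (n : nat) (C F : set 'rV[R]_n) p A :
  face C F -> rel_frame F p A -> F = C `&` [set q | (q - p <= A)%MS].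
Proof.
move=> fF [Fp fA FA]; apply/seteqP; split=> [q Fq|q [Cq qA]].
  by split; [case: fF => FC _ _; exact: FC|exact: FA].
apply: (face_feasible fF Fp Cq); apply: fA.
by rewrite -opprB eqmx_opp.
Qed.

Lemma rel_frame_rank_lt (R : realType) (n : nat) (C F : set 'rV[R]_n) p A q B :
  face C F -> F `<` C -> rel_frame F p A -> rel_frame C q B ->
  (\rank A < \rank B)%N.
Proof.
move=> fF [FC nCF] FA CB.
have AB := rel_frame_sub FC FA CB.
suff : (A < B)%MS by rewrite ltmxErank => /andP[].
rewrite ltmxE AB /=; apply/negP => BA; apply: nCF => z Cz.
rewrite (rel_frame_face fF FA); split=> //=.
case: CB => _ _ CB; have [Fp _ _] := FA.
apply: submx_trans BA; have -> : z - p = (z - q) - (p - q).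
  by rewrite opprB addrA subrK.
by rewrite addmx_sub ?eqmx_opp ?CB //; exact: FC.
Qed.

(** The i-th member of a chain has dimension at most n - i, by strict decrease
of the dimension. *)
Lemma face_chain_size (R : realType) (n : nat) (C : set 'rV[R]_n) s :
  face_chain C s -> (size s <= n.+1)%N.
Proof.
move=> [sF sS].
have frames i : (i < size s)%N ->
    exists p A, rel_frame (nth set0 s i) p A /\ (\rank A + i <= n)%N.
  elim: i => [|i IH] si.
    have [[_ c0 _] F0] := sF _ si.
    have [p [A pA]] := rel_frame_exists c0 F0.
    by exists p, A; rewrite addn0 rank_leq_row.
  have [q [B [qB Bn]]] := IH (ltnW si).
  have [fi1 F0] := sF _ si; have [_ c1 _] := fi1.
  have [fi _] := sF _ (ltnW si); have ss := sS _ si.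
  have [p [A pA]] := rel_frame_exists c1 F0.
  exists p, A; split=> //; apply: leq_trans Bn.
  rewrite addnS -addSn leq_add2r.
  exact: (rel_frame_rank_lt (face_subface fi1 fi ss.1) ss pA qB).
have [-> //|] := posnP (size s).
case: (size s) frames => // k fr _; have [p [A [_]]] := fr k (ltnSn k).
by rewrite ltnS; apply: leq_trans; exact: leq_addl.
Qed.

(** * Closed flats and exit points *)

Lemma continuous_coord_affine (R : realType) (n : nat) (p : 'rV[R]_n)
    (k : 'I_n) (c : R) :
  continuous (fun q : 'rV[R]_n => (q 0 k - p 0 k) * c).
Proof.
move=> q.
have qk : {for q, continuous (fun q : 'rV[R]_n => q 0 k)}.
  exact: coord_continuous.
have qpk : {for q, continuous (fun q : 'rV[R]_n => q 0 k - p 0 k)}.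
  by apply: continuousB qk _; exact: cst_continuous.
exact: continuousM qpk (@cst_continuous _ _ _ _).
Qed.

(** Membership in the row space of A is the vanishing of finitely many linear
forms, the columns of the cokernel of A. *)
Lemma closed_flat (R : realType) (m n : nat) (p : 'rV[R]_n) (A : 'M[R]_(m, n)) :
  closed [set q : 'rV[R]_n | (q - p <= A)%MS].
Proof.
pose f (j : 'I_n) (q : 'rV[R]_n) : R := \sum_k (q 0 k - p 0 k) * cokermx A k j.
have cf j : continuous (f j).
  rewrite /f; elim: (index_enum _) => [|k s IH].
    by under eq_fun do rewrite big_nil; exact: cst_continuous.
  under eq_fun do rewrite big_cons.
  by move=> q; apply: continuousD (IH q); exact: continuous_coord_affine.
rewrite (_ : [set _ | _] = \bigcap_(j in [set: 'I_n]) (f j @^-1` [set 0])).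
  apply: closed_bigI => j _; apply: closed_comp; last exact: closed_eq.
  by move=> q _; exact: cf.
have fE q j : f j q = ((q - p) *m cokermx A) 0 j.
  by rewrite mxE; apply: eq_bigr => k _; rewrite !mxE.
apply/seteqP; split=> q /=; rewrite submxE.
  by move=> /eqP q0 j _ /=; rewrite fE q0 mxE.
by move=> q0; apply/eqP/rowP => j; rewrite -fE [RHS]mxE; exact: q0.
Qed.

Lemma face_compact (R : realType) (n : nat) (C F : set 'rV[R]_n) :
  compact C -> face C F -> F !=set0 -> compact F.
Proof.
move=> kC fF F0; have [_ cF _] := fF.
have [p [A FA]] := rel_frame_exists cF F0.
rewrite (rel_frame_face fF FA); apply: compact_closedI => //.
exact: closed_flat.
Qed.

(** The point y is where the ray from e through x leaves C. It maximises, on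
the compact intersection of C with the line through e and x, a linear form
whose value at e + t (x - e) is a positive multiple of t. *)
Lemma exit_point (R : realType) (n : nat) (C : set 'rV[R]_n) (e x : 'rV[R]_n) :
  compact C -> C e -> C x -> x != e ->
  exists (y : 'rV[R]_n) (a : R), [/\ C y, 0 < a <= 1,
    x = a *: y + (1 - a) *: e & ~ feasible C y (y - e)].
Proof.
move=> kC Ce Cx xe; pose d := x - e.
have [i di] : exists i, d 0 i != 0.
  by apply/rV0Pn; rewrite subr_eq0.
(* A coordinate i in which e and x differ distinguishes the points of the line;
   multiplying by d 0 i orients it from e to x. *)
pose L := C `&` [set q | (q - e <= d)%MS].
pose f (q : 'rV[R]_n) : R := (q 0 i - e 0 i) * d 0 i.
have cf : continuous f by exact: continuous_coord_affine.
have kL : compact L by apply: compact_closedI => //; exact: closed_flat.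
have [|y /set_mem[Cy /= /sub_rVP[t yt]] ymax] :=
    EVT_max_rV _ kL (continuous_subspaceT cf).
  by exists x; split=> //=.
have d2 : 0 < d 0 i * d 0 i by rewrite -expr2 exprn_even_gt0.
have yE : y = e + t *: d by rewrite -yt subrKC.
have fE (c : R) : f (e + c *: d) = c * (d 0 i * d 0 i).
  by rewrite /f !mxE; ring.
have t1 : 1 <= t.
  have : f x <= f y by apply: ymax; apply/mem_set; split=> //=.
  by rewrite -[x](subrKC e) -/d -[d]scale1r yE !fE ler_pM2r.
have t0 : 0 < t by exact: lt_le_trans t1.
exists y, t^-1; split=> //.
- by rewrite invr_gt0 t0 invf_le1.
- rewrite yE scalerDr scalerA mulVf ?gt_eqF // scale1r addrAC -scalerDl.
  by rewrite subrKC scale1r subrKC.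
- move=> [s s0 Cs].
  have : f (y + s *: (y - e)) <= f y.
    apply: ymax; apply/mem_set; split=> //=.
    by rewrite addrAC yt addmx_sub ?scalemx_sub.
  rewrite yt {1}yE scalerA -addrA -scalerDl yE !fE ler_pM2r //.
  by rewrite gerDl leNgt mulr_gt0.
Qed.

(** * Decompositions into extreme points along a chain of faces *)

Lemma conv_comb_extreme1 (R : realType) (V : lmodType R) (C : set V) (e : V) :
  extreme_point C e -> conv_comb_extreme C e 1.
Proof.
move=> xe; exists (fun=> e), (fun=> 1).
by split=> //; rewrite big_ord1 ?scale1r.
Qed.

Lemma conv_comb_extremeS (R : realType) (V : lmodType R) (C : set V) (e y : V)
    (k : nat) (a : R) :
  extreme_point C e -> conv_comb_extreme C y k -> 0 <= a <= 1 ->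
  conv_comb_extreme C (a *: y + (1 - a) *: e) k.+1.
Proof.
move=> xe [f [w [xf w0 w1 ->]]] /andP[a0 a1].
exists (fun i => oapp f e (unlift ord0 i)).
exists (fun i => oapp (fun j => a * w j) (1 - a) (unlift ord0 i)).
split=> [i|i||].
- by case: unliftP => [j|] _ /=.
- by case: unliftP => [j|] _ /=; rewrite ?mulr_ge0 ?subr_ge0.
- rewrite big_ord_recl unlift_none /=.
  under eq_bigr do rewrite liftK /=.
  by rewrite -mulr_sumr w1 mulr1 subrK.
- rewrite big_ord_recl unlift_none /= addrC; congr (_ + _).
  rewrite scaler_sumr; apply: eq_bigr => i _.
  by rewrite liftK /= scalerA.
Qed.

Lemma conv_comb_extreme_face (R : realType) (V : lmodType R) (C F : set V)
    (x : V) (k : nat) :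
  face C F -> conv_comb_extreme F x k -> conv_comb_extreme C x k.
Proof.
move=> fF [e [w [xe w0 w1 xE]]]; exists e, w; split=> // i.
exact: face_trans fF (xe i).
Qed.

(** The weights add up to 1, so the combination is not empty. *)
Lemma conv_comb_extreme_ex (R : realType) (V : lmodType R) (C : set V) (x : V)
    (k : nat) :
  conv_comb_extreme C x k -> exists e, extreme_point C e.
Proof.
case: k => [|k] [e [w [xe w0 w1 xE]]]; last by exists (e ord0).
by move: w1; rewrite big_ord0 => /esym/eqP; rewrite oner_eq0.
Qed.

Lemma face_chain1 (R : realType) (V : lmodType R) (C : set V) :
  convex_set C -> C !=set0 -> face_chain C [:: C].
Proof. by move=> cC C0; split=> -[|i] //= _; split=> //; exact: face_refl. Qed.

Lemma face_chain_cons (R : realType) (V : lmodType R) (C F : set V)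
    (s : seq (set V)) :
  convex_set C -> face C F -> F `<` C -> F !=set0 -> face_chain F s ->
  face_chain C (C :: s).
Proof.
move=> cC fF ltFC [z Fz] [sF sS]; split=> -[|i] /= si.
- by split; [exact: face_refl|exists z; exact: ltFC.1].
- by have [fi i0] := sF i si; split=> //; exact: face_trans fF fi.
- have [[s0F _ _] _] := sF 0%N si; split; first exact: subset_trans s0F ltFC.1.
  by move=> Cs0; apply: ltFC.2; exact: subset_trans Cs0 s0F.
- exact: sS.
Qed.

Lemma extreme_decomposition_chain (R : realType) (n : nat) (C : set 'rV[R]_n)
    (x : 'rV[R]_n) :
  compact C -> convex_set C -> C x ->
  exists2 s, face_chain C s & conv_comb_extreme C x (size s).
Proof.
move=> kC cC Cx; have C0 : C !=set0 by exists x.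
have [p [A CA]] := rel_frame_exists cC C0.
(* Strong induction on the dimension of C. *)
have [d] := ubnP (\rank A); elim: d => // d IH in C x p A kC cC Cx C0 CA *.
rewrite ltnS => Ad.
(* If C stops at y on the ray from z, the minimal face of y misses z, and the
   induction hypothesis applies to it. *)
have smaller_face y z : C y -> C z -> ~ feasible C y (y - z) ->
    exists2 s, face_chain C (C :: s) & conv_comb_extreme C y (size s).
  move=> Cy Cz nz; pose F := min_face C y.
  have fF : face C F by exact: min_face_face.
  have Fy : F y by exact: mem_min_face.
  have F0 : F !=set0 by exists y.
  have ltFC : F `<` C.
    by split=> [q []//|/(_ z Cz) []].
  have [_ cF _] := fF; have kF := face_compact kC fF F0.
  have [q [B FB]] := rel_frame_exists cF F0.
  have Bd := leq_trans (rel_frame_rank_lt fF ltFC FB CA) Ad.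
  have [s sF sy] := IH F y q B kF cF Fy F0 FB Bd.
  by exists s; [exact: face_chain_cons sF|exact: conv_comb_extreme_face sy].
have extr e : extreme_point C e ->
    exists2 s, face_chain C s & conv_comb_extreme C e (size s).
  by exists [:: C]; [exact: face_chain1|exact: conv_comb_extreme1].
(* An extreme point e is needed: it comes from the face in which the ray from x
   through another point b of C exits. *)
have [[b Cb bx]|nb] := pselect (exists2 b, C b & b != x); last first.
  have CE : C = [set x].
    apply/seteqP; split=> [b Cb|b ->//]; apply: contrapT => /eqP bx.
    by apply: nb; exists b.
  by apply: extr; rewrite /extreme_point -CE; exact: face_refl.
have [y [_ [Cy _ _ ny]]] := exit_point kC Cx Cb bx.
have [_ _ /conv_comb_extreme_ex[e xe]] := smaller_face y x Cy Cx ny.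
have Ce : C e by case: xe => eC _ _; exact: eC.
have [->|nxe] := eqVneq x e; first exact: extr.
have [z [a [Cz /andP[a0 a1] xE nz]]] := exit_point kC Ce Cx nxe.
have [s sC sz] := smaller_face z e Cz Ce nz.
exists (C :: s) => //; rewrite xE; apply: conv_comb_extremeS => //.
by rewrite ltW.
Qed.

Theorem theorem6 (R : realType) (n : nat) (C : set 'rV[R]_n)
  (C_nonempty : C !=set0) (C_compact : compact C) (C_convex : convex_set C)
  (x : 'rV[R]_n) (Cx : C x) :
  exists k l : nat,
    [/\ is_kappa C x k, is_chain_length C l & (k <= l)%N].
Proof.
have [s sC sx] := extreme_decomposition_chain C_compact C_convex Cx.
pose K k := `[< conv_comb_extreme C x k >].
have K0 : exists k, K k by exists (size s); apply/asboolP.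
pose L l := `[< exists2 t, face_chain C t & size t = l >].
have L0 : exists l, L l by exists (size s); apply/asboolP; exists s.
have Ln l : L l -> (l <= n.+1)%N.
  by move=> /asboolP[t /face_chain_size tn <-].
have [k /asboolP xk kmin] := ex_minnP K0.
have [l /asboolP Cl lmax] := ex_maxnP L0 Ln.
exists k, l; split.
- by split=> // m xm; apply: kmin; apply/asboolP.
- by split=> // t tC; apply: lmax; apply/asboolP; exists t.
- apply: (@leq_trans (size s)); first by apply: kmin; apply/asboolP.
  by apply: lmax; apply/asboolP; exists s.
Qed.
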